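(* Let $P=[p_{ij}]$ be the $m\times m$ transition matrix of a finite irreducible discrete time Markov chain with state space $S=\{1,2,\dots,m\}$, stationary probabilities $\pi_1,\dots,\pi_m$ and column sum vector $c^T=(c_1,\dots,c_m)$, where $c_j=\sum_{i=1}^m p_{ij}$. Let $H=[h_{ij}]=[I-P+ec^T]^{-1}$, where $e$ is the column vector of ones. Then for all $j\in S=\{1,2,\dots,m\}$, $$\pi_j<mh_{jj}.$$
   Context: $P$ is row-stochastic: $p_{ij}\ge 0$ and $\sum_{j=1}^m p_{ij}=1$ for all $i$. The stationary probability vector $\pi^T=(\pi_1,\dots,\pi_m)$ is the unique vector with $\pi^TP=\pi^T$ and $\pi^Te=1$. $I$ is the $m\times m$ identity matrix. The matrix $I-P+ec^T$ is nonsingular, so $H$ is well defined.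
   Formalization: The chain is assumed to have at least two states (m ≥ 2), because for m = 1 we have P = [1], H = [1] and π_1 = 1, so the strict inequality fails (equality holds). *)

(* Defs.v *)
From mathcomp Require Import all_boot all_order all_algebra.

Set Implicit Arguments.
Unset Strict Implicit.
Unset Printing Implicit Defensive.

Import Order.TTheory GRing.Theory Num.Theory.
Local Open Scope ring_scope.

(** The states 1, ..., m are indexed by 'I_m.  Probabilities lie in an arbitrary
    ordered field, the real numbers being the intended instance. *)

Definition row_stochastic (R : realFieldType) (m : nat) (P : 'M[R]_m) : Prop :=
  (forall i j, 0 <= P i j) /\ (forall i, \sum_(j < m) P i j = 1).

(** Every state is accessible from every state; [(P ^+ n) i j] is the n-step
    transition probability. *)
Definition irreducible_chain (R : realFieldType) (m : nat) (P : 'M[R]_m) : Prop :=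
  forall i j, exists n : nat, 0 < (P ^+ n) i j.

Definition ones (R : realFieldType) (m : nat) : 'cV[R]_m := const_mx 1.

(** For an irreducible stochastic [P], these equations have exactly one solution,
    which is positive. *)
Definition stationary (R : realFieldType) (m : nat) (P : 'M[R]_m)
    (p : 'rV[R]_m) : Prop :=
  p *m P = p /\ p *m ones R m = 1%:M.

(** The row vector c^T. *)
Definition column_sums (R : realFieldType) (m : nat) (P : 'M[R]_m) : 'rV[R]_m :=
  \row_(j < m) \sum_(i < m) P i j.

(** [invmx A] is [A] itself for singular [A], but the matrix inverted here is
    nonsingular whenever [P] is stochastic and irreducible and [0 < m]. *)
Definition Hmx (R : realFieldType) (m : nat) (P : 'M[R]_m) : 'M[R]_m :=
  invmx (1%:M - P + ones R m *m column_sums P).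

(* Main.v *)
(** Put [A = I - P + e c^T].  From [p A = c^T] one gets [c^T H = p], hence
    [(I - P) H = I - e p].  So column [j] of [H] satisfies
    [h_i = \sum_k p_ik h_k - p_j] for [i != j], and as [p_j > 0] its maximum is
    attained at [i = j] only.  Then [p_j = \sum_i c_i h_i < m h_jj], because
    the [c_i] sum to [m] and some [c_i] with [i != j] is positive. *)
Require Import Defs.
From mathcomp Require Import all_boot all_order all_algebra.

Set Implicit Arguments.
Unset Strict Implicit.
Unset Printing Implicit Defensive.

Import Order.TTheory GRing.Theory Num.Theory.
Local Open Scope ring_scope.

Lemma stochastic_expr_ge0 (R : realFieldType) (m : nat) (P : 'M[R]_m) n i j :
  row_stochastic P -> 0 <= (P ^+ n) i j.
Proof.
move=> [P0 _]; elim: n i j => [|n IHn] i j.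
  by rewrite expr0 mxE; case: (_ == _).
by rewrite exprS mxE sumr_ge0 // => k _; rewrite mulr_ge0.
Qed.

Lemma invariant_expr (R : realFieldType) (m : nat) (P : 'M[R]_m)
    (v : 'rV[R]_m) n :
  v *m P = v -> v *m P ^+ n = v.
Proof.
move=> vP; elim: n => [|n IHn]; first by rewrite expr0 mulmx1.
by rewrite exprS mulmxA vP.
Qed.

(** Irreducibility gives an [n] with [(P ^+ n) i j] positive. Since [v = v *m P ^+ n], the entry
    [v 0 j] is a sum of nonnegative terms whose [i]-th term is positive. *)
Lemma invariant_ge0_gt0 (R : realFieldType) (m : nat) (P : 'M[R]_m)
    (v : 'rV[R]_m) i j :
    row_stochastic P -> irreducible_chain P -> v *m P = v ->
  (forall k, 0 <= v 0 k) -> 0 < v 0 i -> 0 < v 0 j.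
Proof.
move=> Pst Pirr vP v0 vi; have [n Pij] := Pirr i j.
rewrite -(invariant_expr n vP) mxE (bigD1 i) //=.
rewrite ltr_pwDl ?mulr_gt0 // sumr_ge0 // => k _.
by rewrite mulr_ge0 ?stochastic_expr_ge0.
Qed.

Lemma sum_mulmx_stochastic (R : realFieldType) (m : nat) (P : 'M[R]_m)
    (v : 'rV[R]_m) :
  row_stochastic P -> \sum_j (v *m P) 0 j = \sum_j v 0 j.
Proof.
move=> [_ P1]; under eq_bigr do rewrite mxE.
by rewrite exchange_big; apply: eq_bigr => i _; rewrite -mulr_sumr P1 mulr1.
Qed.

(* Entrywise [|v| <= |v| P], and both sides have the same sum. *)
Lemma invariant_norm (R : realFieldType) (m : nat) (P : 'M[R]_m)
    (v : 'rV[R]_m) :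
  row_stochastic P -> v *m P = v ->
  map_mx Num.norm v *m P = map_mx Num.norm v.
Proof.
move=> Pst vP; set w := map_mx _ v.
have d0 j : 0 <= (w *m P) 0 j - w 0 j.
  rewrite subr_ge0 {2}/w mxE -{1}vP !mxE (le_trans (ler_norm_sum _ _ _)) //.
  by apply: ler_sum => k _; rewrite normrM mxE (ger0_norm (Pst.1 _ _)).
have ds : \sum_j ((w *m P) 0 j - w 0 j) = 0.
  by rewrite sumrB sum_mulmx_stochastic // subrr.
apply/rowP => j; apply/eqP; rewrite -subr_eq0.
by have /(_ (fun k _ => d0 k))/(_ j isT)/eqP := psumr_eq0P _ ds.
Qed.

(* The nonnegative invariant vectors [|v|] and [|v| - v] each vanish
   identically or are positive everywhere. *)
Lemma invariant_gt0 (R : realFieldType) (m : nat) (P : 'M[R]_m)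
    (v : 'rV[R]_m) :
    row_stochastic P -> irreducible_chain P -> v *m P = v ->
  v != 0 -> 0 <= \sum_j v 0 j -> forall j, 0 < v 0 j.
Proof.
move=> Pst Pirr vP /rV0Pn[i vi] vs j; have wP := invariant_norm Pst vP.
have w_gt0 k : 0 < `|v 0 k|.
  suff : 0 < (map_mx Num.norm v) 0 k by rewrite mxE.
  apply: (invariant_ge0_gt0 (i := i) _ Pst Pirr wP) => [l|].
    by rewrite mxE.
  by rewrite mxE normr_gt0.
have uP : (map_mx Num.norm v - v) *m P = map_mx Num.norm v - v.
  by rewrite mulmxBl wP vP.
have u_ge0 k : 0 <= (map_mx Num.norm v - v) 0 k.
  by rewrite !mxE subr_ge0 ler_norm.
case: (ltgtP 0 (v 0 j)) => [//|vj|vj]; last first.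
  by have := w_gt0 j; rewrite -vj normr0 ltxx.
(* A negative entry at [j] makes [|v| - v] positive at [j], hence everywhere. So every entry of [v]
   is negative, against the nonnegative sum. *)
have v_lt0 k : v 0 k < 0.
  have uj : 0 < (map_mx Num.norm v - v) 0 j.
    by rewrite !mxE subr_gt0 (lt_le_trans vj).
  have := invariant_ge0_gt0 k Pst Pirr uP u_ge0 uj; rewrite !mxE subr_gt0.
  by case: (leP 0 (v 0 k)) => // vk; rewrite ger0_norm // ltxx.
have : \sum_k v 0 k < 0.
  by rewrite (bigD1 j) //= ltr_nwDl // sumr_le0 // => k _; apply: ltW.
by rewrite ltNge vs.
Qed.

Lemma mul_row_ones (R : realFieldType) (m : nat) (v : 'rV[R]_m) :
  v *m ones R m = (\sum_j v 0 j)%:M.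
Proof.
apply/rowP => k; rewrite !ord1 !mxE eqxx mulr1n.
by apply: eq_bigr => i _; rewrite mxE mulr1.
Qed.

Lemma stochastic_ones (R : realFieldType) (m : nat) (P : 'M[R]_m) :
  row_stochastic P -> P *m ones R m = ones R m.
Proof.
move=> [_ P1]; apply/colP => i; rewrite !mxE -[RHS](P1 i).
by apply: eq_bigr => k _; rewrite mxE mulr1.
Qed.

Lemma sum_column_sums (R : realFieldType) (m : nat) (P : 'M[R]_m) :
  row_stochastic P -> \sum_j column_sums P 0 j = m%:R.
Proof.
move=> [_ P1]; under eq_bigr do rewrite mxE.
rewrite exchange_big /= (eq_bigr (fun=> 1)) => [|i _]; last exact: P1.
by rewrite sumr_const card_ord.
Qed.

Lemma column_sums_ge0 (R : realFieldType) (m : nat) (P : 'M[R]_m) j :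
  row_stochastic P -> 0 <= column_sums P 0 j.
Proof. by move=> [P0 _]; rewrite mxE sumr_ge0. Qed.

(** If column [j] of [P] vanished, so would column [j] of every positive power. As [i != j] rules
    out the zeroth power, [j] would be inaccessible from [i]. *)
Lemma column_sums_gt0 (R : realFieldType) (m : nat) (P : 'M[R]_m) i j :
    row_stochastic P -> irreducible_chain P -> i != j ->
  0 < column_sums P 0 j.
Proof.
move=> Pst Pirr ij; rewrite lt0r column_sums_ge0 // andbT mxE.
apply/eqP => /(psumr_eq0P (fun k _ => Pst.1 k j)) Pj0.
have [[|n]] := Pirr i j; first by rewrite expr0 mxE (negPf ij) ltxx.
by rewrite exprSr mxE big1 ?ltxx // => k _; rewrite Pj0 ?mulr0.
Qed.

(** The left kernel is trivial. Multiplying [v *m A = 0] by the ones vector leaves [m] times the sum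
    of [v], so that sum is zero and [v] is invariant under [P]. A nonzero such [v] would be positive
    everywhere, contradicting the zero sum. *)
Lemma fundamental_unitmx (R : realFieldType) (m : nat) (P : 'M[R]_m) :
    (0 < m)%N -> row_stochastic P -> irreducible_chain P ->
  1%:M - P + ones R m *m column_sums P \in unitmx.
Proof.
move=> m_gt0 Pst Pirr; set A := (X in X \in _).
rewrite -row_free_unit -kermx_eq0.
apply/rowV0P => v /sub_kermxP vA.
have vs : \sum_j v 0 j = 0.
  have : v *m A *m ones R m = 0 by rewrite vA mul0mx.
  rewrite -mulmxA mulmxDl mulmxBl mul1mx stochastic_ones // subrr add0r.
  rewrite -mulmxA mul_row_ones sum_column_sums // mulmxA mul_row_ones.
  rewrite -scalar_mxM => /matrixP/(_ 0 0)/eqP; rewrite !mxE eqxx mulr1n.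
  by rewrite mulf_eq0 pnatr_eq0 (gtn_eqF m_gt0) orbF => /eqP.
have vP : v *m P = v.
  move: vA; rewrite mulmxDr mulmxBr mulmx1 mulmxA mul_row_ones vs.
  by rewrite mul_scalar_mx scale0r addr0 => /subr0_eq.
apply/eqP/negPn/negP => v_neq0.
have v_gt0 k : 0 < v 0 k.
  by apply: (invariant_gt0 Pst Pirr vP v_neq0); rewrite vs.
move/psumr_eq0P: vs => /(_ (fun k _ => ltW (v_gt0 k)))/(_ (Ordinal m_gt0) isT).
by apply/eqP; rewrite gt_eqF.
Qed.

Theorem theorem14 (R : realFieldType) (m : nat) (P : 'M[R]_m) (p : 'rV[R]_m)
    (m_gt1 : (1 < m)%N)
    (P_stochastic : row_stochastic P)
    (P_irreducible : irreducible_chain P)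
    (p_stationary : stationary P p) :
  forall j : 'I_m, p 0 j < m%:R * Hmx P j j.
Proof.
move=> j; have [pP p1] := p_stationary.
have A_unit := fundamental_unitmx (ltnW m_gt1) P_stochastic P_irreducible.
have p_gt0 : 0 < p 0 j.
  have ps : \sum_k p 0 k = 1.
    by move/matrixP/(_ 0 0): p1; rewrite mul_row_ones !mxE eqxx !mulr1n.
  apply: invariant_gt0 P_stochastic P_irreducible pP _ _ j.
    apply: contra_eq_neq ps => ->.
    by rewrite big1 ?(eq_sym 0) ?oner_neq0 // => k _; rewrite mxE.
  by rewrite ps ler01.
have cH : column_sums P *m Hmx P = p.
  apply: (can_inj (mulmxK A_unit)); rewrite mulmxKV //.
  by rewrite mulmxDr mulmxBr mulmx1 pP subrr add0r mulmxA p1 mul1mx.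
have H_eq i : Hmx P i j - \sum_k P i k * Hmx P k j = (i == j)%:R - p 0 j.
  have /matrixP/(_ i j) := mulmxV A_unit.
  rewrite -/(Hmx P) mulmxDl mulmxBl mul1mx -mulmxA cH.
  by rewrite !mxE big_ord1 mxE mul1r => <-; rewrite addrK.
(* At a maximal row [i != j], [H_eq] writes [p 0 j] as an average of column [j] minus its maximum,
   which is at most zero. *)
have max_eq i : (forall k, Hmx P k j <= Hmx P i j) -> i = j.
  move=> H_le; apply/eqP; apply: contraTT p_gt0 => /negPf ij; rewrite -leNgt.
  have := H_eq i; rewrite ij sub0r => /(congr1 -%R); rewrite opprK => <-.
  rewrite opprB subr_le0 -[leRHS]mul1r -(P_stochastic.2 i) mulr_suml.
  by apply: ler_sum => k _; rewrite ler_wpM2l ?P_stochastic.1.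
have H_le i : Hmx P i j <= Hmx P j j.
  have [i0 _ i0_max] := @arg_maxP _ _ _ j xpredT (fun k => Hmx P k j) isT.
  have le_i0 k : Hmx P k j <= Hmx P i0 j by exact: i0_max.
  by rewrite -{2}(max_eq i0 le_i0).
(* A row that ties with row [j] would itself be maximal, so [max_eq] would identify it with [j]. *)
have H_lt i : i != j -> Hmx P i j < Hmx P j j.
  move=> ij; rewrite ltNge; apply: contra_neqN ij => ji.
  by apply: max_eq => k; apply: le_trans ji.
have [i ij] : exists i : 'I_m, i != j.
  apply/existsP; apply: contraLR m_gt1.
  rewrite negb_exists -leqNgt => /forallP all_j; rewrite -[m]card_ord.
  by apply/card_le1_eqP => x y _ _; rewrite (eqP (negbNE (all_j x)))
    (eqP (negbNE (all_j y))).
(* Both sides become sums weighted by the column sums and are compared term by term. The term at [i]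
   is strict: its weight is positive because [j] is a state other than [i]. *)
rewrite -(sum_column_sums P_stochastic) mulr_suml -[in ltLHS]cH mxE.
rewrite (bigD1 i) //= [ltRHS](bigD1 i) //= ltr_leD //.
  by rewrite ltr_pM2l ?H_lt ?(column_sums_gt0 _ _ (i := j)) // eq_sym.
by apply: ler_sum => k _; rewrite ler_wpM2l ?column_sums_ge0.
Qed.
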